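(* Let $\mathbb{K}$ be a field, $E$ a finite set and $W\subseteq\mathbb{K}^E$ a configuration, and suppose that $\operatorname{ch}\mathbb{K}=0$ or $\operatorname{ch}\mathbb{K}>\dim_{\mathbb{K}} W$. Let $\nu(W)$ be the minimal number of variables appearing in any polynomial that is contact equivalent to the configuration polynomial $\psi_W$. Then $$\nu(W)\le\binom{\dim_{\mathbb{K}} W+1}{2}.$$ Moreover, this minimum is realized by a configuration polynomial obtained from $W$ by a matroid restriction: there is a subset $F\subseteq E$ with $|F|=\nu(W)$ such that, for the configuration $W':=\pi_F(W)\subseteq\mathbb{K}^F\cong\mathbb{K}^{\nu(W)}$, the polynomials $\psi_W$ and $\psi_{W'}$ are contact equivalent.
   Context: For a finite set $E$, $\mathbb{K}^E$ is the $\mathbb{K}$-vector space with canonical basis $E$; for $w\in\mathbb{K}^E$, $w_e$ denotes its $e$-component. A configuration is a $\mathbb{K}$-linear subspace $W\subseteq\mathbb{K}^E$. For $F\subseteq E$, $\pi_F\colon\mathbb{K}^E\to\mathbb{K}^F$ is the coordinate projection; passing from $W$ to $\pi_F(W)$ realizes the restriction to $F$ of the matroid on $E$ represented by $W$. Configuration polynomial: for a basis $w^1,\dots,w^r$ of $W$ and variables $x=(x_e)_{e\in E}$, $\psi_W:=\det\left(\sum_{e\in E}x_e w^i_e w^j_e\right)_{1\le i,j\le r}\in\mathbb{K}[x]$; it is determined by $W$ up to a square factor in $\mathbb{K}^*$. (Linear) contact equivalence: polynomials $\phi\in\mathbb{K}[x_1,\dots,x_m]$ and $\psi\in\mathbb{K}[x_1,\dots,x_n]$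 are contact equivalent, $\phi\simeq\psi$, if for some $p\ge m,n$ there are $\ell\in\operatorname{GL}_p(\mathbb{K})$ and $\lambda\in\mathbb{K}^*$ with $\phi=\lambda\cdot\psi\circ\ell$ in $\mathbb{K}[x_1,\dots,x_p]$. Configuration polynomials are compared by enumerating $E$ (the enumeration does not affect the equivalence class). *)

(* Defs.v *)
From HB Require Import structures.
From mathcomp Require Import all_boot all_order all_algebra.
From mathcomp Require Import boolp ring.
From mathcomp.multinomials Require Export mpoly.

Set Implicit Arguments.
Unset Strict Implicit.
Unset Printing Implicit Defensive.

Import GRing.Theory.
Local Open Scope ring_scope.

Section ContactEquivalence.
Variable K : fieldType.

Definition mwiden_le n p (le_np : (n <= p)%N) (f : {mpoly K[n]}) :
    {mpoly K[p]} :=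
  f \mPo [tuple 'X_(widen_ord le_np i) | i < n].

(* The composite [f \o l]: x_i is replaced by the i-th entry of [l x]. *)
Definition mlin_comp p (f : {mpoly K[p]}) (l : 'M[K]_p) : {mpoly K[p]} :=
  f \mPo [tuple \sum_(j < p) l i j *: 'X_j | i < p].

Definition contact_equiv m n (phi : {mpoly K[m]}) (psi : {mpoly K[n]}) : Prop :=
  exists (p : nat) (le_mp : (m <= p)%N) (le_np : (n <= p)%N)
         (l : 'M[K]_p) (lambda : K),
    [/\ l \in unitmx, lambda != 0
      & mwiden_le le_mp phi = lambda *: mlin_comp (mwiden_le le_np psi) l].

(* Counts the variables that occur in some monomial of [f]; this is in general
   smaller than the number [n] of variables of the ambient ring. *)
Definition nvars n (f : {mpoly K[n]}) : nat :=
  #|[set i : 'I_n | has (fun m : 'X_{1..n} => (0 < m i)%N) (msupp f)]|.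

Definition contact_equiv_nvars n (psi : {mpoly K[n]}) (k : nat) : Prop :=
  exists (m : nat) (phi : {mpoly K[m]}), contact_equiv phi psi /\ nvars phi = k.

Lemma contact_equiv_refl n (psi : {mpoly K[n]}) : contact_equiv psi psi.
Proof.
exists n, (leqnn n), (leqnn n), 1%:M, 1; split.
- exact: unitmx1.
- exact: oner_neq0.
rewrite scale1r /mlin_comp -[LHS]comp_mpoly_id; congr (_ \mPo _).
apply: eq_from_tnth => i; rewrite !tnth_mktuple (bigD1 i) //= mxE eqxx scale1r.
by rewrite big1 ?addr0 // => j ji; rewrite mxE eq_sym (negbTE ji) scale0r.
Qed.

Lemma contact_equiv_nvars_ex n (psi : {mpoly K[n]}) :
  exists k, `[< contact_equiv_nvars psi k >].
Proof.
exists (nvars psi); apply/asboolP; exists n, psi.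
by split; first exact: contact_equiv_refl.
Qed.

Definition min_nvars n (psi : {mpoly K[n]}) : nat :=
  ex_minn (contact_equiv_nvars_ex psi).

End ContactEquivalence.

Section Configurations.
Variables (K : fieldType) (E : finType).

Definition config_mx r (w : r.-tuple {ffun E -> K^o}) : 'M[{mpoly K[#|E|]}]_r :=
  \matrix_(i, j) \sum_(e : E)
    (tnth w i e * tnth w j e : K) *: 'X_(enum_rank e).

(* Another choice of basis changes the determinant by a nonzero square factor:
   see [config_poly_basis] below. *)
Definition config_poly (W : {vspace {ffun E -> K^o}}) : {mpoly K[#|E|]} :=
  \det (config_mx (vbasis W)).

Definition nu (W : {vspace {ffun E -> K^o}}) : nat := min_nvars (config_poly W).

Definition proj_ffun (F : {set E}) (w : {ffun E -> K^o}) :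
    {ffun {e : E | e \in F} -> K^o} :=
  [ffun f => w (val f)].

Fact proj_ffun_is_linear (F : {set E}) : linear (proj_ffun F).
Proof. by move=> a u v; apply/ffunP => f; rewrite !ffunE. Qed.

HB.instance Definition _ (F : {set E}) :=
  GRing.isLinear.Build K {ffun E -> K^o} {ffun {e : E | e \in F} -> K^o} _
    (proj_ffun F) (proj_ffun_is_linear F).

Definition config_restr (F : {set E}) (W : {vspace {ffun E -> K^o}}) :
    {vspace {ffun {e : E | e \in F} -> K^o}} :=
  (linfun (proj_ffun F) @: W)%VS.

Lemma config_poly_basis (W : {vspace {ffun E -> K^o}})
    (w : (\dim W).-tuple {ffun E -> K^o}) :
  basis_of W w ->
  exists2 c : K, c != 0 & \det (config_mx w) = c ^+ 2 *: config_poly W.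
Proof.
move=> bw; have bv := vbasisP W.
pose T (u v : (\dim W).-tuple {ffun E -> K^o}) : 'M[K]_(\dim W) :=
  \matrix_(i, j) coord u j (tnth v i).
have TE (u v : (\dim W).-tuple {ffun E -> K^o}) : basis_of W u ->
    basis_of W v -> forall i, tnth v i = \sum_j T u v i j *: tnth u j.
  move=> bu bv' i; rewrite {1}(coord_basis bu (basis_mem bv' (mem_tnth i v))).
  by apply: eq_bigr => j _; rewrite mxE [tnth u j](tnth_nth 0).
have T1 : T w (vbasis W) *m T (vbasis W) w = 1%:M.
  apply/matrixP => i k; rewrite mxE.
  transitivity (coord (vbasis W) k (tnth (vbasis W) i)); last first.
    by rewrite (tnth_nth 0) coord_free ?(basis_free bv) // mxE.
  rewrite [in RHS](TE _ _ bw bv i) linear_sum /=.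
  by apply: eq_bigr => j _; rewrite linearZ /= [T (vbasis W) w j k]mxE.
have uT : \det (T (vbasis W) w) != 0.
  by have := mulmx1_unit T1; rewrite !unitmxE !unitfE => -[].
exists (\det (T (vbasis W) w)) => //.
set A := T _ _.
have wE i e : tnth w i e = \sum_k (A i k * tnth (vbasis W) k e : K).
  by rewrite (TE _ _ bv bw i) sum_ffunE; apply: eq_bigr => k _; rewrite ffunE.
have -> : config_mx w =
    map_mx (@mpolyC #|E| K) A *m config_mx (vbasis W)
      *m (map_mx (@mpolyC #|E| K) A)^T.
  move: A wE => A wE; apply/matrixP => i j; rewrite !mxE.
  under [RHS]eq_bigr => l _.
    rewrite !mxE mulr_suml.
    under eq_bigr => k _ do rewrite !mxE mulr_sumr mulr_suml.
    rewrite exchange_big /=.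
    over.
  rewrite [RHS]exchange_big /=; apply: eq_bigr => e _.
  rewrite !wE big_distrlr /= exchange_big scaler_suml /=.
  apply: eq_bigr => l _; rewrite scaler_suml; apply: eq_bigr => k _.
  rewrite mul_mpolyC [RHS]mulrC mul_mpolyC !scalerA; congr (_ *: _); ring.
rewrite !det_mulmx det_tr det_map_mx /= mulrAC -rmorphM -expr2 mul_mpolyC.
by [].
Qed.

End Configurations.

(* Main.v *)
Require Import Defs.
From mathcomp Require Import all_boot all_order all_algebra.

(* Let [v_e] be the rows of the matrix [V] of a basis of [W]; then [psi_W] is
   the determinant of [sum_e x_e v_e^T v_e].  Choosing [F] so that the matrices
   [v_e^T v_e], [e] in [F], form a basis of the span of all of them turns [psi_W]
   into [psi_W'] by a linear substitution of full rank, which extends to an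
   invertible one.  Conversely, a polynomial equivalent to [psi_W] with fewer
   variables would make [psi_W] invariant under translation by some [a] with
   [A = sum_e a_e v_e^T v_e <> 0].  But adding suitable [r - rank A] matrices
   [v_e^T v_e] to [A] makes it invertible, whereas their sum alone is singular. *)

Set Implicit Arguments.
Unset Strict Implicit.
Unset Printing Implicit Defensive.

Import GRing.Theory.
Local Open Scope ring_scope.

(** * Evaluation of substituted polynomials; contact equivalence and the minimal number of
    variables *)

Section ContactEquivalence.
Variable K : fieldType.

Lemma mwiden_leE n p (le_np : (n <= p)%N) (f : {mpoly K[n]}) (v : 'I_p -> K) :
  (mwiden_le le_np f).@[v] = f.@[fun i => v (widen_ord le_np i)].
Proof.
rewrite comp_mpoly_meval; apply: meval_eq => i.
by rewrite tnth_mktuple mevalXU.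
Qed.

Lemma mlin_compE p (f : {mpoly K[p]}) (l : 'M[K]_p) (v : 'I_p -> K) :
  (mlin_comp f l).@[v] = f.@[fun i => \sum_j l i j * v j].
Proof.
rewrite comp_mpoly_meval; apply: meval_eq => i.
rewrite tnth_mktuple rmorph_sum /=; apply: eq_bigr => j _.
by rewrite mevalZ mevalXU.
Qed.

Lemma mwiden_le_id n (le_nn : (n <= n)%N) (f : {mpoly K[n]}) :
  mwiden_le le_nn f = f.
Proof.
by rewrite -[RHS]comp_mpoly_id; congr (_ \mPo _).
Qed.

Lemma mlin_comp1 p (f : {mpoly K[p]}) : mlin_comp f 1%:M = f.
Proof.
rewrite -[RHS]comp_mpoly_id; congr (_ \mPo _).
apply: eq_from_tnth => i; rewrite !tnth_mktuple (bigD1 i) //= mxE eqxx scale1r.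
by rewrite big1 ?addr0 // => j ji; rewrite mxE eq_sym (negbTE ji) scale0r.
Qed.

Lemma mlin_compM p (f : {mpoly K[p]}) (l l' : 'M[K]_p) :
  mlin_comp (mlin_comp f l) l' = mlin_comp f (l *m l').
Proof.
rewrite /mlin_comp [f \mPo _]comp_mpolyE [RHS]comp_mpolyE raddf_sum /=.
apply: eq_bigr => m _; rewrite comp_mpolyZ rmorph_prod; congr (_ *: _).
apply: eq_bigr => i _; rewrite rmorphXn /=; congr (_ ^+ _).
rewrite !tnth_mktuple raddf_sum /=.
under eq_bigr => j _.
  rewrite comp_mpolyZ comp_mpolyXU -tnth_nth tnth_mktuple scaler_sumr.
  over.
rewrite exchange_big /=; apply: eq_bigr => k _.
by rewrite mxE scaler_suml; apply: eq_bigr => j _; rewrite scalerA.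
Qed.

Lemma mlin_compZ p c (f : {mpoly K[p]}) (l : 'M[K]_p) :
  mlin_comp (c *: f) l = c *: mlin_comp f l.
Proof. exact: comp_mpolyZ. Qed.

Lemma contact_equiv_sym m n (phi : {mpoly K[m]}) (psi : {mpoly K[n]}) :
  contact_equiv phi psi -> contact_equiv psi phi.
Proof.
case=> p [le_mp [le_np [l [c [ul c0 phiE]]]]].
exists p, le_np, le_mp, (invmx l), c^-1.
split; [by rewrite unitmx_inv | by rewrite invr_eq0 |].
rewrite phiE mlin_compZ mlin_compM mulmxV // mlin_comp1 scalerA mulVf //.
by rewrite scale1r.
Qed.

Lemma contact_equivZr m n c (phi : {mpoly K[m]}) (psi : {mpoly K[n]}) :
  c != 0 -> contact_equiv phi psi -> contact_equiv phi (c *: psi).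
Proof.
move=> c0 [p [le_mp [le_np [l [d [ul d0 phiE]]]]]].
exists p, le_mp, le_np, l, (d / c).
split; [exact: ul | by rewrite mulf_neq0 ?invr_eq0 |].
by rewrite phiE /mwiden_le comp_mpolyZ mlin_compZ scalerA divfK.
Qed.

Lemma meval_eq_supp n (f : {mpoly K[n]}) (v v' : 'I_n -> K) :
    (forall i, has (fun m : 'X_{1..n} => (0 < m i)%N) (msupp f) ->
      v i = v' i) ->
  f.@[v] = f.@[v'].
Proof.
move=> vE; rewrite !mevalE; apply: eq_big_seq => m mf; congr (_ * _).
apply: eq_bigr => i _; case: (posnP (m i)) => [-> // | mi].
by rewrite vE //; apply/hasP; exists m.
Qed.

Lemma min_nvars_le m n (phi : {mpoly K[m]}) (psi : {mpoly K[n]}) :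
  contact_equiv phi psi -> (min_nvars psi <= nvars phi)%N.
Proof.
move=> phipsi; rewrite /min_nvars; case: ex_minnP => k _; apply.
by apply/boolp.asboolP; exists m, phi.
Qed.

Lemma min_nvars_attained n (psi : {mpoly K[n]}) :
  contact_equiv_nvars psi (min_nvars psi).
Proof. by rewrite /min_nvars; case: ex_minnP => k /boolp.asboolP. Qed.

End ContactEquivalence.

(** * The span of the matrices [v_e^T v_e] and its dimension *)

Section GramMatrices.
Variable K : fieldType.

(* Row [e] is the rank one symmetric matrix [v^T v], [v] the row [e] of [V]. *)
Definition gram_rows n r (V : 'M[K]_(n, r)) : 'M[K]_(n, r * r) :=
  \matrix_e mxvec ((row e V)^T *m row e V).

Definition gram_poly n r (V : 'M[K]_(n, r)) : {mpoly K[n]} :=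
  \det (\matrix_(i, j) \sum_e (V e i * V e j) *: 'X_e : 'M[{mpoly K[n]}]_r).

Lemma gram_rowsE n r (V : 'M[K]_(n, r)) e i j :
  gram_rows V e (mxvec_index i j) = V e i * V e j.
Proof. by rewrite mxE mxvecE mxE big_ord1 !mxE. Qed.

Lemma row_gram_rows n r (V : 'M[K]_(n, r)) e :
  row e (gram_rows V) = mxvec ((row e V)^T *m row e V).
Proof. exact: rowK. Qed.

Lemma gram_rows_rowsub m n r (g : 'I_m -> 'I_n) (V : 'M[K]_(n, r)) :
  gram_rows (rowsub g V) = rowsub g (gram_rows V).
Proof. by apply/row_matrixP => e; rewrite rowK !row_rowsub rowK. Qed.

Lemma gram_comb_sym n r (V : 'M[K]_(n, r)) (c : 'rV_n) :
  (vec_mx (c *m gram_rows V))^T = vec_mx (c *m gram_rows V).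
Proof.
apply/matrixP => i j; rewrite !mxE; apply: eq_bigr => e _.
by rewrite !gram_rowsE [V e i * _]mulrC.
Qed.

Lemma gram_polyE n r (V : 'M[K]_(n, r)) (c : 'I_n -> K) :
  (gram_poly V).@[c] = \det (vec_mx (\row_e c e *m gram_rows V)).
Proof.
rewrite -det_map_mx; congr (\det _); apply/matrixP => i j.
rewrite !mxE rmorph_sum /=; apply: eq_bigr => e _.
by rewrite mevalZ mevalXU gram_rowsE mxE mulrC.
Qed.

(** Pairing [v^T v] with [y y^T] gives the square of [v y]. Hence [v y = 0] is a linear condition on
    [v^T v] and passes to linear combinations. This will show that [proj_ffun F] is injective on
    [W]. *)
Lemma gram_rows_kernel m n r (V : 'M[K]_(n, r)) (V' : 'M_(m, r)) (y : 'cV_r) :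
  (gram_rows V <= gram_rows V')%MS -> V' *m y = 0 -> V *m y = 0.
Proof.
have evalE k (U : 'M_(k, r)) e :
    (gram_rows U *m (mxvec (y *m y^T))^T) e 0 = (U *m y) e 0 ^+ 2.
  transitivity ((row e (gram_rows U) *m (mxvec (y *m y^T))^T) 0 0).
    by rewrite -row_mul [RHS]mxE.
  rewrite row_gram_rows mxvec_dotmul mulmxA -mulmxA -trmx_mul -row_mul.
  by rewrite mxE big_ord1 !mxE expr2.
case/submxP=> X VE V'y; apply/colP => e; rewrite [RHS]mxE; apply/eqP.
rewrite -sqrf_eq0 -evalE VE -mulmxA.
suff -> : gram_rows V' *m (mxvec (y *m y^T))^T = 0 by rewrite mulmx0 mxE.
by apply/colP => f; rewrite evalE V'y !mxE expr0n.
Qed.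

Lemma row_free_completion m n (le_mn : (m <= n)%N) (L : 'M[K]_(m, n)) :
    row_free L ->
  exists2 l : 'M_n, l \in unitmx & forall i j, l (widen_ord le_mn i) j = L i j.
Proof.
move=> /eqP rL; have nE := subnKC le_mn.
move: (n - m)%N nE => d nE; subst n.
(* The rank factorization of [L] is [C [1 0] R] with [C], [R] invertible; an identity block is added
   below [C]. *)
exists (block_mx (col_ebase L) 0 0 1%:M *m row_ebase L).
  rewrite unitmx_mul row_ebase_unit andbT unitmxE det_ublock det1 mulr1.
  by rewrite -unitmxE col_ebase_unit.
move=> i j; rewrite -[in RHS](mulmx_ebase L) rL pid_mx_row mul_mx_row mulmx1.
rewrite mulmx0 mxE [RHS]mxE; apply: eq_bigr => k _; congr (_ * _).
have -> : widen_ord le_mn i = lshift d i by apply: val_inj.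
by rewrite /block_mx col_mxEu.
Qed.

(** Replacing the variable [x_f] of [gram_poly V'] by [\sum_e X e f x_e] yields [gram_poly V]. These
    linear forms are independent, so they extend to an invertible substitution in [n] variables. *)
Lemma contact_equiv_gram_poly m n r (V : 'M[K]_(n, r)) (V' : 'M_(m, r)) X :
    row_free X^T -> gram_rows V = X *m gram_rows V' ->
  contact_equiv (gram_poly V) (gram_poly V').
Proof.
move=> fX VE; have le_mn : (m <= n)%N by rewrite -(eqP fX) rank_leq_col.
have [l ul lE] := row_free_completion le_mn fX.
exists n, (leqnn n), le_mn, l, 1; split; [exact: ul | exact: oner_neq0 |].
rewrite mwiden_le_id scale1r /mlin_comp /mwiden_le -!det_map_mx.
congr (\det _); apply/matrixP => i j; rewrite !mxE /=.
rewrite [X in X \mPo _]raddf_sum /= raddf_sum /=.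
under [RHS]eq_bigr => f _.
  rewrite !comp_mpolyZ !comp_mpolyXU -tnth_nth tnth_mktuple comp_mpolyXU.
  rewrite -tnth_nth tnth_mktuple scaler_sumr.
  over.
rewrite exchange_big /=; apply: eq_bigr => e _.
rewrite -gram_rowsE VE mxE scaler_suml; apply: eq_bigr => f _.
by rewrite scalerA gram_rowsE lE mxE mulrC.
Qed.

(** A vector [y] with [y A = 0] and [y v^T = 1] satisfies [y (A + v^T v) = v]. So the row space of
    the sum contains [v], hence also that of [A], properly. *)
Lemma symmx_rank_add1 r (A : 'M[K]_r) (v : 'rV_r) :
  A^T = A -> ~~ (v <= A)%MS -> (\rank A < \rank (A + v^T *m v)%R)%N.
Proof.
move=> symA vA; apply: rank_ltmx.
have [y yA yv] : exists2 y : 'rV_r, y *m A = 0 & (y *m v^T) 0 0 = 1.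
  move: vA; rewrite submxE => /eqP; case: (pickP (fun j =>
    (v *m cokermx A) 0 j != 0)) => [j nz _ | z []]; last first.
    by apply/rowP => j; apply/eqP; rewrite [X in _ == X]mxE -[_ == _]negbK z.
  set a := _ 0 j in nz.
  (* Columns of [cokermx A] are killed by [A] from the left; by symmetry their transposes lie in the
     left kernel. Dividing by [a] normalizes the pairing with [v]. *)
  exists (a^-1 *: (col j (cokermx A))^T).
    apply: trmx_inj; rewrite -scalemxAl linearZ /= trmx_mul trmxK symA.
    by rewrite colE mulmxA mulmx_coker mul0mx scaler0 trmx0.
  rewrite -scalemxAl -trmx_mul colE mulmxA -colE mxE [(_^T) 0 0]mxE.
  rewrite [col _ _ _ _]mxE.
  by rewrite mulVf.
have yAv : y *m (A + v^T *m v) = v.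
  by rewrite mulmxDr yA add0r mulmxA [y *m v^T]mx11_scalar yv mul1mx.
have vS : (v <= (A + v^T *m v)%R)%MS by rewrite -[X in (X <= _)%MS]yAv submxMl.
rewrite ltmxE; apply/andP; split; last first.
  by apply: contra vA; apply: submx_trans.
rewrite -[X in (X <= _)%MS](addrK (v^T *m v)) addmx_sub //.
by rewrite eqmx_opp mulmx_sub.
Qed.

(* Adding a rank one matrix [v_e^T v_e] with [v_e] outside the row space of [A]
   raises the rank of [A] by one; iterate until [A] becomes invertible. *)
Lemma gram_completion n r (V : 'M[K]_(n, r)) (A : 'M_r) :
    row_full V -> A^T = A ->
  exists2 c : 'rV_n, (\rank (vec_mx (c *m gram_rows V)) <= r - \rank A)%N
    & A + vec_mx (c *m gram_rows V) \in unitmx.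
Proof.
move=> fV; move: {2}(r - \rank A)%N (leqnn (r - \rank A)) => k.
elim: k A => [|k IHk] A lek symA; case: (boolP (row_full A)) => [fA | fA].
- by exists 0; rewrite mul0mx linear0 ?mxrank0 // addr0 -row_full_unit.
- by case/negP: fA; rewrite /row_full eqn_leq rank_leq_col -subn_eq0 -leqn0.
- by exists 0; rewrite mul0mx linear0 ?mxrank0 // addr0 -row_full_unit.
(* The rows of [V] span the whole space, so they cannot all lie in the proper row space of [A]. *)
have [e veA] : exists e, ~~ (row e V <= A)%MS.
  case: (pickP (fun e => ~~ (row e V <= A)%MS)) => [e|VA]; first by exists e.
  case/negP: fA; rewrite -sub1mx (submx_trans _ (_ : V <= A)%MS) ?sub1mx //.
  by apply/row_subP => e; apply/negbFE/VA.
have ltA := symmx_rank_add1 symA veA.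
have := rank_leq_row (A + (row e V)^T *m row e V) => leA'.
have [||c rc uc] := IHk (A + (row e V)^T *m row e V).
- by rewrite -ltnS (leq_trans _ lek) // ltn_sub2l // (leq_trans ltA).
- by rewrite linearD /= symA trmx_mul trmxK.
have cE : vec_mx ((c + delta_mx 0 e) *m gram_rows V) =
    vec_mx (c *m gram_rows V) + (row e V)^T *m row e V.
  by rewrite mulmxDl linearD /= -rowE row_gram_rows mxvecK.
exists (c + delta_mx 0 e); rewrite cE; last by rewrite [X in A + X]addrC addrA.
(* The new term adds at most 1 to the rank of the combination, while [r - \rank A] has dropped by at
   least 1. *)
apply: leq_trans (mxrank_add _ _) _.
apply: leq_trans (leq_add rc (mxrankM_maxr _ _)) _.
apply: leq_trans (leq_add (leqnn _) (rank_leq_row _)) _.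
by rewrite addn1 ltn_sub2l // (leq_trans ltA).
Qed.

Lemma gram_rows_translation n r (V : 'M[K]_(n, r)) (a : 'rV_n) :
    row_full V ->
    (forall c, (gram_poly V).@[fun e => c e + a 0 e] = (gram_poly V).@[c]) ->
  a *m gram_rows V = 0.
Proof.
move=> fV inv; apply/eqP; apply: contraT => nz.
set A := vec_mx (a *m gram_rows V).
have rA : (0 < \rank A)%N.
  rewrite lt0n mxrank_eq0; apply: contra nz => /eqP A0.
  by rewrite -[_ *m _]vec_mxK -/A A0 linear0.
have [c rc] := gram_completion fV (gram_comb_sym V a).
have := inv (c 0); rewrite !gram_polyE.
have -> : \row_e c 0 e = c by apply/rowP => e; rewrite mxE.
have -> : \row_e (c 0 e + a 0 e) = c + a by apply/rowP => e; rewrite !mxE.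
(* With [C] the combination given by [c], invariance equates the determinants of [A + C] and [C]. So
   [C] would be invertible, against its rank being at most [r - \rank A < r]. *)
rewrite mulmxDl linearD /= -/A addrC unitmxE => ->; rewrite -unitmxE.
rewrite -row_free_unit /row_free => /eqP rcE; move: rc; rewrite rcE -/A.
have rlt := leq_trans rA (rank_leq_row A).
by rewrite leqNgt ltn_subrL rA rlt.
Qed.

(* A polynomial equivalent to [gram_poly V] is invariant under translation along
   the variables that it does not contain. *)
Lemma gram_rows_rank_le_nvars m n r (V : 'M[K]_(n, r)) (phi : {mpoly K[m]}) :
    row_full V -> contact_equiv phi (gram_poly V) ->
  (\rank (gram_rows V) <= nvars phi)%N.
Proof.
move=> fV [p [le_mp [le_np [l [d [ul d0 phiE]]]]]].
set I := [set i : 'I_m | has (fun mm : 'X_{1..m} => (0 < mm i)%N) (msupp phi)].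
pose w := widen_ord le_np.
pose P : 'M[K]_(p, n) := colsub w 1%:M.
(* Moving the [p] variables by [b] moves the argument of [gram_poly V] by [a = b l^T P], and
   [b *m T] encodes the matrix [\sum_e a_e v_e^T v_e]. The rank is unchanged because [l] is
   invertible and [P] has a left inverse. *)
pose T := l^T *m P *m gram_rows V.
have rT : \rank T = \rank (gram_rows V).
  have VT : gram_rows V = rowsub w (invmx l^T) *m T.
    rewrite mul_rowsub_mx /T !mulmxA mulVmx ?unitmx_tr // mul1mx.
    rewrite -mul_rowsub_mx; have -> : rowsub w P = 1%:M; last by rewrite mul1mx.
    by apply/matrixP => i j; rewrite !mxE.
  by apply/eqP; rewrite eqn_leq mxrankM_maxr {1}VT mxrankM_maxr.
pose g (k : 'I_#|I|) := widen_ord le_mp (enum_val k).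
have rowT (b : 'rV_p) : (forall i, i \in I -> b 0 (widen_ord le_mp i) = 0) ->
    b *m T = 0.
  move=> bI; rewrite /T !mulmxA; apply: gram_rows_translation => // c.
  (* The point that [l] sends to [c], padded by zeros in the extra coordinates. *)
  pose x : 'rV_p := (\row_j (if insub (val j) is Some i then c i else 0))
    *m (invmx l)^T.
  have xl : x *m l^T = \row_j (if insub (val j) is Some i then c i else 0).
    by rewrite -mulmxA -trmx_mul mulmxV // trmx1 mulmx1.
  have wK e : insub (val (w e)) = Some e by rewrite -[val (w e)]/(val e) valK.
  have lP (y : 'rV_p) i : \sum_j l i j * y 0 j = (y *m l^T) 0 i.
    by rewrite mxE; apply: eq_bigr => j _; rewrite mxE mulrC.
  have evE (y : 'rV_p) : (mwiden_le le_mp phi).@[y 0] =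
      d * (gram_poly V).@[fun e => (y *m l^T) 0 (w e)].
    rewrite phiE mevalZ mlin_compE mwiden_leE; congr (_ * _).
    by apply: meval_eq => e; rewrite lP.
  have : (mwiden_le le_mp phi).@[(x + b) 0] = (mwiden_le le_mp phi).@[x 0].
    rewrite !mwiden_leE; apply: meval_eq_supp => i iI.
    by rewrite mxE bI ?addr0 // inE.
  rewrite !evE => /(mulfI d0).
  have -> : (gram_poly V).@[fun e => (x *m l^T) 0 (w e)] = (gram_poly V).@[c].
    by apply: meval_eq => e; rewrite xl mxE wK.
  move=> <-; apply: meval_eq => e.
  rewrite mulmxDl xl [RHS]mxE [X in _ = X + _]mxE wK; congr (_ + _).
  by rewrite /P mulmx_colsub mulmx1 mxE.
(* Rows of [T] whose index is not a variable of [phi] vanish, so the [#|I|] remaining rows span its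
   row space. *)
rewrite -rT; apply: leq_trans (rank_leq_row (rowsub g T)).
apply: mxrankS; apply/row_subP => j.
case: (pickP (fun k => g k == j)) => [k /eqP <- | gj].
  by rewrite -row_rowsub row_sub.
rewrite rowE rowT ?sub0mx // => i iI; rewrite mxE /=.
case: eqP => //= ij; have := gj (enum_rank_in iI i).
by rewrite /g enum_rankK_in // ij eqxx.
Qed.

(** By symmetry of [v^T v], the columns at [(i, j)] and [(j, i)] coincide, so those with [i <= j]
    span the column space. *)
Lemma gram_rows_rank_le n r (V : 'M[K]_(n, r)) :
  (\rank (gram_rows V) <= 'C(r.+1, 2))%N.
Proof.
pose I := [set ij : 'I_r * 'I_r | (ij.1 <= ij.2)%N].
pose g (k : 'I_#|I|) := mxvec_index (enum_val k).1 (enum_val k).2.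
(* Pairs are counted by their larger entry [j], which occurs in [j.+1] of them. *)
have cI : #|I| = 'C(r.+1, 2).
  rewrite -bin2_sum big_mkord big_ord_recl add0n -sum1dep_card.
  rewrite -(pair_big_dep xpredT (fun i j : 'I_r => (i <= j)%N)
    (fun _ _ => 1%N)).
  rewrite (exchange_big_dep xpredT) //=; apply: eq_bigr => j _.
  rewrite sum1dep_card -[RHS]card_ord /= /bump /=.
  have ltj : (j.+1 <= r)%N := ltn_ord j.
  have inj : injective (widen_ord ltj) by move=> a b [] /val_inj.
  rewrite -[RHS](card_codom inj); apply: eq_card => i; rewrite inE.
  apply/idP/codomP => [leij | [k ->]]; last exact: (ltn_ord k).
  by exists (Ordinal (leij : i < j.+1)%N); apply: val_inj.
rewrite -cI -mxrank_tr.
apply: leq_trans (rank_leq_row (rowsub g (gram_rows V)^T)).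
apply: mxrankS; apply/row_subP => k; case/mxvec_indexP: k => i j.
have rowI (a b : 'I_r) : (a <= b)%N ->
    (row (mxvec_index a b) (gram_rows V)^T <= rowsub g (gram_rows V)^T)%MS.
  move=> leab; have abI : (a, b) \in I by rewrite inE.
  have -> : mxvec_index a b = g (enum_rank_in abI (a, b)).
    by rewrite /g enum_rankK_in.
  by rewrite -row_rowsub row_sub.
case: (leqP i j) => [|/ltnW] leij; first exact: rowI.
suff -> : row (mxvec_index i j) (gram_rows V)^T =
    row (mxvec_index j i) (gram_rows V)^T by apply: rowI.
by apply/rowP => e; rewrite !mxE !mxvecE !mxE !big_ord1 !mxE mulrC.
Qed.

End GramMatrices.

(** * Configuration polynomials as Gram polynomials *)

Section Configurations.
Variables (K : fieldType).

Definition tuple_mx (E : finType) r (w : r.-tuple {ffun E -> K^o}) :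
    'M[K]_(#|E|, r) :=
  \matrix_(e, i) tnth w i (enum_val e).

Lemma det_config_mx (E : finType) r (w : r.-tuple {ffun E -> K^o}) :
  \det (config_mx w) = gram_poly (tuple_mx w).
Proof.
congr (\det _); apply/matrixP => i j; rewrite !mxE.
rewrite (reindex_onto (@enum_val E E) enum_rank) /=; last first.
  by move=> e _; apply: enum_rankK.
apply: eq_big => [e|e _]; first by rewrite enum_valK eqxx.
by rewrite !mxE enum_valK.
Qed.

Lemma tuple_mx_full (E : finType) r (w : r.-tuple {ffun E -> K^o}) :
  free w -> row_full (tuple_mx w).
Proof.
move=> /freeP fw; rewrite /row_full -mxrank_tr; apply: inj_row_free => y yw.
apply/rowP => i; rewrite mxE; apply: fw; apply/ffunP => e.
rewrite sum_ffunE ffunE.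
have /rowP/(_ (enum_rank e)) := yw; rewrite !mxE => yw0; rewrite -[RHS]yw0.
by apply: eq_bigr => j _; rewrite ffunE !mxE enum_rankK (tnth_nth 0).
Qed.

(** The length [r] is kept apart from [\dim W] so that the image of a basis of [W] can be used, with
    its original length, as a basis of the restriction. *)
Lemma config_poly_gram (E : finType) (W : {vspace {ffun E -> K^o}}) r
    (w : r.-tuple {ffun E -> K^o}) : basis_of W w ->
  exists2 c : K, c != 0 & gram_poly (tuple_mx w) = c ^+ 2 *: config_poly W.
Proof.
move=> bw; have rE : r = \dim W by rewrite (size_basis bw).
by subst r; rewrite -det_config_mx; apply: config_poly_basis.
Qed.

End Configurations.

(** * Choice of the restriction and determination of [nu W] *)

Theorem theorem1p1 (K : fieldType) (E : finType)
    (W : {vspace {ffun E -> K^o}})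
    (hK : [pchar K] =i pred0 \/
          (exists2 p : nat, p \in [pchar K] & (\dim W < p)%N)) :
  (nu W <= 'C((\dim W).+1, 2))%N /\
  (exists F : {set E},
     #|F| = nu W /\
     contact_equiv (config_poly W) (config_poly (config_restr F W))).
Proof.
pose V := tuple_mx (vbasis W); have bW := vbasisP W.
have psiE : config_poly W = gram_poly V := det_config_mx _.
have fV : row_full V := tuple_mx_full (basis_free bW).
pose f := maxrankfun (gram_rows V).
(* [maxrankfun] selects independent rows spanning the row space of [gram_rows V]; [F] consists of
   the corresponding elements of [E]. *)
pose F : {set E} := [set enum_val (f k) | k in 'I_(\rank (gram_rows V))].
have cF : #|F| = \rank (gram_rows V).
  rewrite card_imset ?card_ord //.
  by move=> a b /enum_val_inj /maxrankfun_inj.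
(* [g] passes from the enumeration of [F] to that of [E], which may order the elements differently
   from [f]. *)
pose g (i : 'I_#|{: {e : E | e \in F}}|) := enum_rank (val (enum_val i)).
pose V' := rowsub g V.
have leV : (gram_rows V <= gram_rows V')%MS.
  rewrite -(eq_maxrowsub (gram_rows V)) gram_rows_rowsub.
  apply/row_subP => k; rewrite row_rowsub -/f.
  have kF : enum_val (f k) \in F by apply: imset_f.
  pose i := enum_rank (Sub (enum_val (f k)) kF : {e : E | e \in F}).
  have -> : f k = g i by rewrite /g enum_rankK SubK enum_valK.
  by rewrite -row_rowsub row_sub.
have restrE u (fe : {e : E | e \in F}) : linfun (proj_ffun F) u fe = u (val fe).
  by rewrite lfunE ffunE.
(* Injectivity of the projection on [W]: if the coordinates of [u] in [F] vanish, then [V' y = 0]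
   for its coefficient vector [y], hence [V y = 0]. So the basis of [W] projects to a basis of the
   restriction. *)
have kerW : (W :&: lker (linfun (proj_ffun F)) = 0)%VS.
  apply/eqP; rewrite -subv0; apply/subvP => u; rewrite memv_cap memv_ker memv0.
  case/andP=> uW /eqP u0; have uE := coord_basis bW uW.
  pose y : 'cV[K]_(\dim W) := \col_i coord (vbasis W) i u.
  have VyE e : (V *m y) e 0 = u (enum_val e).
    rewrite mxE [in RHS]uE sum_ffunE; apply: eq_bigr => i _.
    by rewrite ffunE !mxE (tnth_nth 0) mulrC.
  have Vy : V *m y = 0.
    apply: gram_rows_kernel leV _; rewrite mul_rowsub_mx; apply/colP => i.
    by rewrite mxE VyE enum_rankK -restrE u0 ffunE mxE.
  by apply/eqP/ffunP => e; rewrite -[e]enum_rankK -VyE Vy mxE ffunE.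
pose w' := map_tuple (linfun (proj_ffun F)) (vbasis W).
have bW' : basis_of (config_restr F W) w' by apply: limg_basis_of.
have V'E : tuple_mx w' = V'.
  by apply/matrixP => i j; rewrite !mxE tnth_map restrE enum_rankK.
have cE : contact_equiv (config_poly W) (config_poly (config_restr F W)).
  have [c c0 cE] := config_poly_gram bW'.
  have -> : config_poly (config_restr F W) = (c ^+ 2)^-1 *: gram_poly V'.
    by rewrite -V'E cE scalerA mulVf ?scale1r ?expf_neq0.
  rewrite psiE; apply: contact_equivZr; first by rewrite invr_eq0 expf_neq0.
  have /submxP[X VE] := leV; apply: (contact_equiv_gram_poly _ VE).
  (* [X] has [#|F|] columns, and its rank is at least that of [X *m gram_rows V'], which is
     [#|F|]. *)
  rewrite /row_free eqn_leq rank_leq_row mxrank_tr.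
  by rewrite [X in (X <= _)%N]card_sig [X in (X <= _)%N]cF VE mxrankM_maxl.
(* The restricted polynomial bounds [nu W] above, having only [#|F|] variables available; the rank
   bound, applied to a polynomial attaining the minimum, bounds it below. *)
have nuE : nu W = #|F|.
  apply/eqP; rewrite eqn_leq; apply/andP; split; last first.
    have [m [phi [phiW nuE]]] := min_nvars_attained (config_poly W).
    rewrite /nu -nuE cF; apply: (gram_rows_rank_le_nvars fV).
    by rewrite -psiE.
  apply: leq_trans (min_nvars_le (contact_equiv_sym cE)) _.
  by apply: leq_trans (max_card _) _; rewrite card_ord card_sig.
split; first by rewrite nuE cF gram_rows_rank_le.
by exists F.
Qed.
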